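(* For every composition $\alpha$ of $n$, there are isomorphisms of $H_n(0)$-modules $$\mathcal{P}_\alpha\cong\mathsf{B}(w_0(\alpha^{\mathrm c}),\,w_0\,w_0(\alpha))\quad\text{and}\quad \mathbf{F}_\alpha\cong\mathsf{B}(w_0(\alpha^{\mathrm c}),\,w_0(\alpha^{\mathrm c})).$$
   Context: Permutations in $\mathfrak{S}_n$ are composed as functions; $s_i=(i,i+1)$; $\ell$ is the Coxeter length; $w_0$ is the longest element of $\mathfrak{S}_n$; $\mathrm{Des}_L(\sigma)=\{i\in[n-1]\mid \ell(s_i\sigma)<\ell(\sigma)\}$. Left weak Bruhat order: $\sigma\preceq_L\rho$ iff $\rho=\gamma\sigma$ with $\ell(\rho)=\ell(\gamma)+\ell(\sigma)$ for some $\gamma$; $[\sigma,\rho]_L=\{\gamma\mid\sigma\preceq_L\gamma\preceq_L\rho\}$. For a composition $\alpha=(\alpha_1,\dots,\alpha_k)$ of $n$, $\mathrm{set}(\alpha)=\{\alpha_1,\alpha_1+\alpha_2,\dots,\alpha_1+\cdots+\alpha_{k-1}\}\subseteq[n-1]$, and $\alpha^{\mathrm c}$ is the composition of $n$ with $\mathrm{set}(\alpha^{\mathrm c})=[n-1]\setminus\mathrm{set}(\alpha)$. $w_0(\alpha)$ is the longest element of the parabolic subgroup of $\mathfrak{S}_n$ generated by $\{s_i\mid i\in\mathrm{set}(\alpha)\}$. $H_n(0)$ is the unital $\mathbb{C}$-algebra generated by $\pi_1,\dots,\pi_{n-1}$ with relations $\pi_i^2=\pi_i$, $\pi_i\pi_{i+1}\pi_i=\pi_{i+1}\pi_i\pi_{i+1}$,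 $\pi_i\pi_j=\pi_j\pi_i$ for $|i-j|\ge2$; $\overline{\pi}_i:=\pi_i-1$; $\pi_\sigma,\overline{\pi}_\sigma$ are the products of the $\pi_i$, resp. $\overline{\pi}_i$, along any reduced expression of $\sigma$. $\mathcal{P}_\alpha:=H_n(0)\pi_{w_0(\alpha^{\mathrm c})}\overline{\pi}_{w_0(\alpha)}$ (a projective indecomposable module). $\mathbf{F}_\alpha=\mathbb{C}v_\alpha$ is the one-dimensional module with $\pi_i v_\alpha=0$ if $i\in\mathrm{set}(\alpha)$ and $\pi_iv_\alpha=v_\alpha$ otherwise. $\mathsf{B}(\sigma,\rho)$ is the left $H_n(0)$-module with basis $[\sigma,\rho]_L$ and action: $\pi_i\cdot\gamma=\gamma$ if $i\in\mathrm{Des}_L(\gamma)$; $\pi_i\cdot\gamma=0$ if $i\notin\mathrm{Des}_L(\gamma)$ and $s_i\gamma\notin[\sigma,\rho]_L$; $\pi_i\cdot\gamma=s_i\gamma$ if $i\notin\mathrm{Des}_L(\gamma)$ and $s_i\gamma\in[\sigma,\rho]_L$. *)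

(* Defs.v *)
From HB Require Import structures.
From mathcomp Require Import all_boot all_order all_fingroup all_algebra.
From mathcomp Require Import generic_quotient ring_quotient finmap monalg.
From mathcomp Require Import boolp reals complex.
From mathcomp Require Import zify.

Set Implicit Arguments.
Unset Strict Implicit.
Unset Printing Implicit Defensive.

Import GRing.Theory.
Local Open Scope ring_scope.

(* Everything is 0-based: i : 'I_n.-1 stands for the index i + 1 of [n - 1],
   and x : 'I_n for the point x + 1 of [n]. *)

(* (s * t)%g applies s first; s \oS t applies t first. *)
Definition perm_comp n (s t : 'S_n) : 'S_n := (t * s)%g.
Notation "s \oS t" := (perm_comp s t) (at level 40, left associativity).

Section SymmetricGroup.
Context {n : nat}.
Implicit Types (i j : 'I_n.-1) (s t r : 'S_n) (w : seq 'I_n.-1).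

Lemma perm_compE s t x : (s \oS t) x = s (t x).
Proof. by rewrite permM. Qed.

Lemma perm_compA s t r : s \oS (t \oS r) = (s \oS t) \oS r.
Proof. by rewrite /perm_comp mulgA. Qed.

Lemma perm_comp1s s : 1%g \oS s = s. Proof. exact: mulg1. Qed.

Fact ltn_succ_pred i : (i.+1 < n)%N.
Proof. by case: n i => [[]//|m] [i hi] /=. Qed.

Definition ord_lo i : 'I_n := widen_ord (leq_pred n) i.
Definition ord_hi i : 'I_n := Ordinal (ltn_succ_pred i).

Definition simple i : 'S_n := tperm (ord_lo i) (ord_hi i).

Definition word_perm w : 'S_n := foldr (fun i s => simple i \oS s) 1%g w.

Definition has_word s k : bool :=
  [exists w : k.-tuple 'I_n.-1, word_perm w == s].

Lemma word_perm_cat w1 w2 :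
  word_perm (w1 ++ w2) = word_perm w1 \oS word_perm w2.
Proof. by elim: w1 => [|i w ih] /=; rewrite ?perm_comp1s // ih perm_compA. Qed.

Lemma simpleK i s : simple i \oS (simple i \oS s) = s.
Proof. by rewrite /perm_comp -mulgA tperm2 mulg1. Qed.

Lemma ord_lo_hi i : ord_lo i != ord_hi i.
Proof. by rewrite -val_eqE /= neq_ltn leqnn. Qed.

(* The combinatorial form of a left descent, see DesLE. *)
Definition desc i s := (s^-1%g (ord_hi i) < s^-1%g (ord_lo i))%N.

Definition inversions s :=
  [set p : 'I_n * 'I_n | (p.1 < p.2)%N && (s^-1%g p.2 < s^-1%g p.1)%N].

Lemma simpleV i s x : (simple i \oS s)^-1%g x = s^-1%g (simple i x).
Proof. by rewrite invMg permM tpermV. Qed.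

Lemma simple_lo i : simple i (ord_lo i) = ord_hi i.
Proof. exact: tpermL. Qed.

Lemma simple_hi i : simple i (ord_hi i) = ord_lo i.
Proof. exact: tpermR. Qed.

Lemma simple_lt i (a b : 'I_n) : (a, b) != (ord_lo i, ord_hi i) ->
  (a < b)%N -> (simple i a < simple i b)%N.
Proof.
rewrite xpair_eqE -!val_eqE /simple /=.
case: tpermP => [->|->|/eqP + /eqP];
  case: tpermP => [->|->|/eqP + /eqP]; rewrite -?val_eqE /=; lia.
Qed.

Lemma asc_desc i s : (s^-1%g (ord_lo i) < s^-1%g (ord_hi i))%N = ~~ desc i s.
Proof.
rewrite /desc -leqNgt [in RHS]leq_eqVlt.
by rewrite val_eqE (inj_eq perm_inj) (negPf (ord_lo_hi i)).
Qed.

Lemma desc_simple i s : desc i (simple i \oS s) = ~~ desc i s.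
Proof. by rewrite -asc_desc /desc !simpleV simple_lo simple_hi. Qed.

Lemma card_inversions i s : ~~ desc i s ->
  #|inversions (simple i \oS s)| = #|inversions s|.+1.
Proof.
move=> asc; pose p0 := (ord_lo i, ord_hi i).
pose f (p : 'I_n * 'I_n) := (simple i p.1, simple i p.2).
have fK : involutive f.
  by move=> [a b]; rewrite /f /= !tpermK.
have fE p (A : {set 'I_n * 'I_n}) : (p \in f @: A) = (f p \in A).
  by rewrite -{1}[p]fK mem_imset //; apply: inv_inj.
have -> : inversions (simple i \oS s) = p0 |: f @: inversions s.
  apply/setP=> -[a b]; rewrite in_setU1 fE !inE !simpleV /=.
  have [[-> ->]|ne] /= := eqVneq (a, b) p0.
    by rewrite ltnSn simple_lo simple_hi asc_desc.
  have [ab|nab] /= := boolP (a < b)%N; first by rewrite (simple_lt ne ab).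
  apply/esym/negP=> /andP[ab' lt].
  have [[ea eb]|/simple_lt/(_ ab')] := eqVneq (simple i a, simple i b) p0.
    by move: lt; rewrite ea eb ltnNge ltnW // asc_desc.
  by rewrite !tpermK (negPf nab).
rewrite cardsU1 (card_imset _ (inv_inj fK)) fE inE /= simple_lo simple_hi /=.
by rewrite ltnNge leqnSn.
Qed.

Lemma desc_inversions i s : desc i s ->
  #|inversions s| = #|inversions (simple i \oS s)|.+1.
Proof. by move=> d; rewrite -(@card_inversions i) ?simpleK ?desc_simple ?d. Qed.

Lemma inversions1 : inversions 1 = set0.
Proof. by apply/setP=> p; rewrite !inE invg1 !perm1; lia. Qed.

Lemma no_desc_id s : (forall i, ~~ desc i s) -> s = 1%g.
Proof.
move=> nd; suff e : s^-1%g = 1%g by rewrite -[s]invgK e invg1.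
have mono : {homo s^-1%g : x y / (x < y)%N}.
  move=> x y; have [k] := ubnP (y - x); elim: k y => // k ih y le xy.
  have y1 : (y.-1 < n.-1)%N by have := ltn_ord y; lia.
  pose i := Ordinal y1.
  have ey : y = ord_hi i by apply: val_inj => /=; lia.
  have := nd i; rewrite -asc_desc -ey.
  have [->//|xi] := eqVneq x (ord_lo i).
  apply: ltn_trans; apply: ih; rewrite /=; first by lia.
  by move: xi; rewrite -val_eqE /=; lia.
apply/permP=> x; rewrite perm1; apply: val_inj => /=.
have lo : forall k (y : 'I_n), y = k :> nat -> (k <= s^-1%g y)%N.
  elim=> // k ih y ey.
  have kn : (k < n)%N by have := ltn_ord y; lia.
  by apply: leq_ltn_trans (ih (Ordinal kn) erefl) (mono _ _ _); rewrite /= ey.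
have hi : forall k (y : 'I_n), (y + k.+1 = n)%N -> (s^-1%g y + k.+1 <= n)%N.
  elim=> [|k ih] y ey; first by rewrite addn1 ltn_ord.
  have kn : (y.+1 < n)%N by lia.
  have /= := ih (Ordinal kn); have /= := mono y (Ordinal kn) (ltnSn y).
  by lia.
have := lo x x erefl; have := hi (n - x.+1)%N x; have := ltn_ord x; lia.
Qed.

Lemma inversions_word w : (#|inversions (word_perm w)| <= size w)%N.
Proof.
elim: w => [|i w ih] /=; first by rewrite inversions1 cards0.
have [d|d] := boolP (desc i (word_perm w)).
  by rewrite (desc_inversions d) in ih; apply: leqW (ltnW ih).
by rewrite card_inversions.
Qed.

Lemma has_word_inversions s : has_word s #|inversions s|.
Proof.
have [k] := ubnP #|inversions s|; elim: k s => // k ih s le.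
have [/forallP nd|] := boolP [forall i, ~~ desc i s].
  rewrite (no_desc_id nd) inversions1 cards0.
  by apply/existsP; exists [tuple].
case/forallPn=> i /negPn d.
have := ih (simple i \oS s); rewrite (desc_inversions d) in le *.
move=> /(_ le) /existsP[w /eqP ew]; apply/existsP; exists [tuple of i :: w].
by rewrite /= ew simpleK.
Qed.

Fact word_exists s : exists k, has_word s k.
Proof. by exists #|inversions s|; apply: has_word_inversions. Qed.

(* Coxeter length; len_inversions identifies it with the inversion number. *)
Definition len s : nat := ex_minn (word_exists s).

Lemma len_inversions s : len s = #|inversions s|.
Proof.
rewrite /len; case: ex_minnP => k /existsP[w /eqP <-] min; apply/eqP.
rewrite eqn_leq min ?has_word_inversions //=.
by apply: leq_trans (inversions_word w) _; rewrite size_tuple.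
Qed.

Definition DesL s : {set 'I_n.-1} := [set i | (len (simple i \oS s) < len s)%N].

Lemma DesLE i s : (i \in DesL s) = desc i s.
Proof.
rewrite inE !len_inversions; have [d|d] := boolP (desc i s).
  by rewrite (desc_inversions d) ltnSn.
by rewrite card_inversions // ltnNge leqnSn.
Qed.

Definition w0 : 'S_n := [arg max_(s > 1%g) len s]%N.

Definition w0_par (D : {set 'I_n.-1}) : 'S_n :=
  [arg max_(s > 1%g in <<[set simple i | i in D]>>%g) len s]%N.

Definition weakL s r : bool :=
  [exists g, (r == g \oS s) && (len r == len g + len s)%N].

Definition itvL s r : {set 'S_n} := [set g | weakL s g && weakL g r].

Lemma len_word w : (len (word_perm w) <= size w)%N.
Proof. by rewrite len_inversions inversions_word. Qed.

Fact reduced_exists s :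
  exists w : (len s).-tuple 'I_n.-1, word_perm w == s.
Proof. by apply/existsP; rewrite /len; case: ex_minnP. Qed.

Definition reduced_word s : seq 'I_n.-1 := xchoose (reduced_exists s).

Lemma reduced_wordP s :
  word_perm (reduced_word s) = s /\ size (reduced_word s) = len s.
Proof. by rewrite size_tuple (eqP (xchooseP (reduced_exists s))). Qed.

Lemma len_comp s t : (len (s \oS t) <= len s + len t)%N.
Proof.
have [e1 <-] := reduced_wordP s; have [e2 <-] := reduced_wordP t.
by rewrite -{1}e1 -{1}e2 -word_perm_cat -size_cat len_word.
Qed.

Lemma weakL_trans : transitive weakL.
Proof.
move=> s r t /existsP[g /andP[/eqP e1 /eqP l1]].
move=> /existsP[h /andP[/eqP e2 /eqP l2]].
apply/existsP; exists (h \oS g); rewrite -perm_compA -e1 -e2 eqxx /=.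
have := len_comp (h \oS g) r; rewrite -perm_compA -e1 -e2.
by have := len_comp h g; lia.
Qed.

Definition dem i s : 'S_n := if i \in DesL s then s else simple i \oS s.

Lemma demE i s : dem i s = if desc i s then s else simple i \oS s.
Proof. by rewrite /dem DesLE. Qed.

Lemma len1 : len 1%g = 0%N.
Proof. by rewrite len_inversions inversions1 cards0. Qed.

Lemma len_simple i : len (simple i) = 1%N.
Proof.
have -> : simple i = simple i \oS 1%g by rewrite /perm_comp mul1g.
rewrite len_inversions card_inversions ?inversions1 ?cards0 //.
by rewrite /desc invg1 !perm1 /= ltnNge leqnSn.
Qed.

Lemma dem_weakL i s : weakL s (dem i s).
Proof.
rewrite demE; apply/existsP; have [d|d] := boolP (desc i s).
  by exists 1%g; rewrite perm_comp1s len1 !eqxx.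
by exists (simple i); rewrite eqxx len_simple !len_inversions card_inversions /=.
Qed.

Lemma dem_idem i s : dem i (dem i s) = dem i s.
Proof.
rewrite [dem i s]demE; case: ifP => d; first by rewrite demE d.
by rewrite demE desc_simple d.
Qed.

Lemma simple_far i x : x != ord_lo i -> x != ord_hi i -> simple i x = x.
Proof. by move=> h1 h2; rewrite tpermD // eq_sym. Qed.

Lemma simple_conj i j s :
  simple i \oS (simple j \oS (simple i \oS s)) = (simple j ^ simple i)%g \oS s.
Proof. by rewrite /perm_comp conjgE /simple tpermV !mulgA. Qed.

Lemma simple_comm i j s : (i.+1 < j)%N ->
  simple i \oS (simple j \oS s) = simple j \oS (simple i \oS s).
Proof.
move=> ij; rewrite -[in RHS](simpleK i s) [X in _ = _ \oS X]simpleK.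
rewrite -[in RHS](simpleK i (simple j \oS _)) simple_conj /simple tpermJ.
by rewrite -/(simple i) !simple_far // -val_eqE /=; lia.
Qed.

Lemma simple_braid i j s : j = i.+1 :> nat ->
  simple i \oS (simple j \oS (simple i \oS s)) =
  simple j \oS (simple i \oS (simple j \oS s)).
Proof.
move=> ij; have hl : ord_lo j = ord_hi i by apply: val_inj.
rewrite !simple_conj /simple !tpermJ -/(simple i) -/(simple j).
rewrite hl simple_hi -hl simple_lo !simple_far // -val_eqE /=; lia.
Qed.

Lemma dem_comm i j s : (i.+1 < j)%N -> dem i (dem j s) = dem j (dem i s).
Proof.
move=> ij.
have e1 : desc i (simple j \oS s) = desc i s.
  by rewrite /desc !simpleV !simple_far // -val_eqE /=; lia.
have e2 : desc j (simple i \oS s) = desc j s.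
  by rewrite /desc !simpleV !simple_far // -val_eqE /=; lia.
rewrite (demE j s) (demE i s); case: ifP => dj; case: ifP => di.
- by rewrite !demE di dj.
- by rewrite !demE di e2 dj.
- by rewrite !demE dj e1 di.
- by rewrite !demE e1 e2 di dj simple_comm.
Qed.

Lemma dem_braid i j s : j = i.+1 :> nat ->
  dem i (dem j (dem i s)) = dem j (dem i (dem j s)).
Proof.
move=> ij; have hl : ord_lo j = ord_hi i by apply: val_inj.
have fhj : simple i (ord_hi j) = ord_hi j.
  by rewrite simple_far // -val_eqE /=; lia.
have fli : simple j (ord_lo i) = ord_lo i.
  by rewrite simple_far // -val_eqE /=; lia.
pose D := (s^-1%g (ord_hi j) < s^-1%g (ord_lo i))%N.
have e1 : desc j (simple i \oS s) = D.
  by rewrite /desc !simpleV fhj hl simple_hi.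
have e2 : desc i (simple j \oS s) = D.
  by rewrite /desc !simpleV fli -hl simple_lo.
have e3 : desc i (simple j \oS (simple i \oS s)) = desc j s.
  by rewrite /desc !simpleV fli -hl simple_lo fhj simple_lo hl.
have e4 : desc j (simple i \oS (simple j \oS s)) = desc i s.
  by rewrite /desc !simpleV fhj simple_hi hl simple_hi fli.
have dD : desc i s -> desc j s -> D by rewrite /desc /D hl => h /ltn_trans; apply.
have aD : ~~ desc i s -> ~~ desc j s -> ~~ D.
  by rewrite -!asc_desc /D hl -leqNgt => h /(ltn_trans h) /ltnW.
pose E := (demE i s, demE j s, demE j (simple i \oS s), demE i (simple j \oS s),
  demE i (simple i \oS s), demE j (simple j \oS s),
  demE i (simple j \oS (simple i \oS s)),
  demE j (simple i \oS (simple j \oS s)),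
  e1, e2, e3, e4, desc_simple).
case: (boolP (desc i s)) (boolP (desc j s)) dD aD => [di|/negPf di] [dj|/negPf dj].
- by move=> _ _; rewrite !(E, di, dj).
- by move=> _ _; rewrite !(E, di, dj); case: ifP => h; rewrite !(E, di, dj, h).
- by move=> _ _; rewrite !(E, di, dj); case: ifP => h; rewrite !(E, di, dj, h).
- move=> _ /(_ isT isT) /negPf h.
  by rewrite !(E, di, dj, h) simple_braid.
Qed.

Lemma desc_far i j s : (i.+1 < j)%N || (j.+1 < i)%N ->
  desc i (simple j \oS s) = desc i s.
Proof.
by move=> ij; rewrite /desc !simpleV !simple_far // -val_eqE /=; lia.
Qed.

Lemma desc_adj i j s : j = i.+1 :> nat -> desc i s -> desc j s ->
  [/\ desc j (simple i \oS s), desc i (simple j \oS s),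
      desc i (simple j \oS (simple i \oS s))
    & desc j (simple i \oS (simple j \oS s))].
Proof.
move=> ij; have hl : ord_lo j = ord_hi i by apply: val_inj.
have fhj : simple i (ord_hi j) = ord_hi j.
  by rewrite simple_far // -val_eqE /=; lia.
have fli : simple j (ord_lo i) = ord_lo i.
  by rewrite simple_far // -val_eqE /=; lia.
move=> di dj; have D : (s^-1%g (ord_hi j) < s^-1%g (ord_lo i))%N.
  by move: dj; rewrite /desc hl => /ltn_trans; apply.
move: (di) (dj); rewrite /desc hl => di' dj'; split; rewrite !simpleV.
- by rewrite fhj simple_hi.
- by rewrite fli -hl simple_lo.
- by rewrite fli -hl simple_lo fhj simple_lo.
- by rewrite fhj !simple_hi fli hl.
Qed.

Lemma len_simple_desc i s : desc i s -> len s = (len (simple i \oS s)).+1.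
Proof. by move=> d; rewrite !len_inversions (desc_inversions d). Qed.

Definition reduced w : bool := size w == len (word_perm w).

Lemma reduced_cons i w : reduced (i :: w) ->
  reduced w /\ desc i (word_perm (i :: w)).
Proof.
rewrite /reduced /= desc_simple => /eqP e; have := len_word w.
have [d|d] := boolP (desc i (word_perm w)).
  by move: (len_simple_desc d) e; lia.
have := @len_simple_desc i (simple i \oS word_perm w).
by rewrite desc_simple simpleK d -e => /(_ isT) [->].
Qed.

Lemma braid_prod (A : nzRingType) (a : 'I_n.-1 -> A) :
    (forall i j, j = i.+1 :> nat -> a i * a j * a i = a j * a i * a j) ->
    (forall i j, (i.+1 < j)%N || (j.+1 < i)%N -> a i * a j = a j * a i) ->
  forall u v, reduced u -> reduced v -> word_perm u = word_perm v ->
  \prod_(i <- u) a i = \prod_(i <- v) a i.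
Proof.
move=> braid comm u; have [k] := ubnP (size u).
elim: k u => // k ih [|i u] lek [|j v] ru rv e.
- by [].
- by move: rv; rewrite /reduced -e /= len1.
- by move: ru; rewrite /reduced e /= len1.
have [ru' di] := reduced_cons ru; have [rv' dj] := reduced_cons rv.
rewrite -e in dj; rewrite !big_cons; set w := word_perm (i :: u) in e di dj.
have eu : word_perm u = simple i \oS w by rewrite /w /= simpleK.
have ev : word_perm v = simple j \oS w by rewrite e /= simpleK.
have redt s x : desc x s -> reduced (x :: reduced_word (simple x \oS s)).
  have [e1 e2] := reduced_wordP (simple x \oS s).
  by move=> d; rewrite /reduced /= e1 e2 simpleK (len_simple_desc d).
have wt s x : word_perm (x :: reduced_word (simple x \oS s)) = s.
  by have [e1 _] := reduced_wordP (simple x \oS s); rewrite /= e1 simpleK.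
have sz : size u = size v.
  by move: ru' rv'; rewrite /reduced => /eqP -> /eqP ->; rewrite eu ev;
    apply: succn_inj; rewrite -!len_simple_desc.
have lu : (size u < k)%N by [].
have lv : (size v < k)%N by rewrite -sz.
have {lek ru rv} key (x y : 'I_n.-1) (u1 v1 : seq 'I_n.-1) : (x < y)%N -> desc x w -> desc y w ->
    (size u1 < k)%N -> (size v1 < k)%N -> reduced u1 -> reduced v1 ->
    word_perm u1 = simple x \oS w -> word_perm v1 = simple y \oS w ->
  a x * \prod_(i <- u1) a i = a y * \prod_(i <- v1) a i.
  move=> xy dx dy l1 l2 r1 r2 e1 e2; have [yx|yx] := eqVneq (val y) x.+1.
    have [d1 d2 d3 d4] := desc_adj yx dx dy.
    have t1 := wt (simple y \oS (simple x \oS w)) x.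
    have t2 := wt (simple x \oS (simple y \oS w)) y.
    have eT := simple_braid w yx.
    rewrite [LHS]/= in t1; rewrite [LHS]/= in t2.
    set T := reduced_word (simple x \oS (simple y \oS (simple x \oS w))) in t1.
    rewrite -eT -/T in t2.
    rewrite (ih u1 l1 (y :: x :: T)) //; first last.
    - by rewrite e1 /= t1 simpleK.
    - have [_ eS] := reduced_wordP (simple x \oS (simple y \oS (simple x \oS w))).
      rewrite /reduced /= t1 simpleK.
      by rewrite eS (len_simple_desc d1) (len_simple_desc d3).
    rewrite (ih v1 l2 (x :: y :: T)) //; first last.
    - by rewrite e2 /= t2 simpleK.
    - have [_ eS] := reduced_wordP (simple x \oS (simple y \oS (simple x \oS w))).
      rewrite /reduced /= t2 simpleK.
      by rewrite eS eT (len_simple_desc d2) (len_simple_desc d4).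
    by rewrite !big_cons !mulrA braid.
  have xy2 : (x.+1 < y)%N by rewrite ltn_neqAle eq_sym yx.
  rewrite (ih u1 l1 (y :: reduced_word (simple y \oS (simple x \oS w)))) //.
  - rewrite (ih v1 l2 (x :: reduced_word (simple x \oS (simple y \oS w)))) //.
    + by rewrite (simple_comm w xy2) !big_cons !mulrA comm ?xy2.
    + by apply: redt; rewrite desc_far ?xy2.
    + by rewrite wt.
  - by apply: redt; rewrite desc_far ?xy2 ?orbT.
  - by rewrite wt.
case: (ltngtP i j) => [ij|ij|/val_inj ij]; first exact: key.
  by apply/esym/key.
by subst j; congr (_ * _); apply: ih => //; rewrite eu ev.
Qed.

End SymmetricGroup.

Record composition (n : nat) := Composition {
  parts :> seq nat;
  compositionP : all (leq 1) parts && (sumn parts == n)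
}.

HB.instance Definition _ n := [isSub for @parts n].
HB.instance Definition _ n := [Choice of composition n by <:].

(* The total sum of a is not among its partial sums. *)
Definition partial_sums (a : seq nat) : seq nat :=
  [seq sumn (take k a) | k <- iota 1 (size a).-1].

Section Compositions.
Context {n : nat}.

Definition comp_set (a : composition n) : {set 'I_n.-1} :=
  [set i : 'I_n.-1 | i.+1 \in partial_sums a].

Lemma partial_sums_path b m (s : seq nat) :
    path ltn b s -> all (fun x => x < m)%N s -> (b < m)%N ->
  exists a, [/\ all (leq 1) a, sumn a = (m - b)%N
              & [seq (b + x)%N | x <- partial_sums a] = s].
Proof.
elim: s b => [|x s ih] b /=.
  by move=> _ _ bm; exists [:: (m - b)%N]; rewrite /= addn0 subn_gt0 bm.
move=> /andP[bx px] /andP[xm sm] _; have [a [pa sa ea]] := ih x px sm xm.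
exists ((x - b)%N :: a); split=> /=; first by rewrite subn_gt0 bx.
  by rewrite sa; lia.
have a0 : size a = (size a).-1.+1 by case: a sa {pa ea} => //=; lia.
rewrite /partial_sums /= a0 /= take0 /= addn0 subnKC 1?ltnW //; congr (_ :: _).
rewrite -ea /partial_sums -[2%N]/(1 + 1)%N iotaDl -!map_comp.
by apply: eq_map => k /=; rewrite add0n; lia.
Qed.

Fact comp_set_surj (D : {set 'I_n.-1}) :
  exists a : composition n, comp_set a == D.
Proof.
have [n0|n_gt0] := posnP n.
  have c : all (leq 1) [::] && (sumn [::] == n) by rewrite n0.
  exists (Composition c); apply/eqP/setP=> i.
  by have := ltn_succ_pred i; lia.
pose s := [seq i.+1 | i : 'I_n.-1 in D].
have ms k : (k \in s) = [exists i in D, k == i.+1 :> nat].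
  apply/imageP/exists_inP => -[i iD e]; exists i => //; first exact/eqP.
  exact/eqP.
pose t := [seq k <- iota 0 n | k \in s].
have [||//|a [pa sa ea]] := @partial_sums_path 0 n t.
- rewrite path_min_sorted; last first.
    apply/allP=> k; rewrite mem_filter ms => /andP[/exists_inP[i _ /eqP ->]] //.
  by rewrite sorted_filter ?iota_ltn_sorted //; apply: ltn_trans.
- by apply/allP=> k; rewrite mem_filter mem_iota => /andP[].
have c : all (leq 1) a && (sumn a == n) by rewrite pa sa subn0 eqxx.
exists (Composition c); apply/eqP/setP=> i; rewrite inE /=.
rewrite (_ : partial_sums a = t); last first.
  by rewrite -ea (eq_map (g := id)) ?map_id.
rewrite mem_filter mem_iota /= ltn_succ_pred andbT ms.
apply/exists_inP/idP => [[j jD /eqP [/val_inj ->]] //|iD].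
by exists i.
Qed.

Definition comp_compl (a : composition n) : composition n :=
  xchoose (comp_set_surj (~: comp_set a)).

Lemma comp_complP a : comp_set (comp_compl a) = ~: comp_set a.
Proof. exact/eqP/(xchooseP (comp_set_surj _)). Qed.

Definition w0_comp (a : composition n) : 'S_n := w0_par (comp_set a).

End Compositions.

Section TwoSidedIdeal.
Context {A : nzRingType}.

Inductive ideal_gen (S : A -> Prop) : A -> Prop :=
| ideal_gen_incl x : S x -> ideal_gen S x
| ideal_gen0 : ideal_gen S 0
| ideal_genB x y : ideal_gen S x -> ideal_gen S y -> ideal_gen S (x - y)
| ideal_genMl a x : ideal_gen S x -> ideal_gen S (a * x)
| ideal_genMr a x : ideal_gen S x -> ideal_gen S (x * a).

End TwoSidedIdeal.

Section FreeAlgebraAction.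
Context {K : fieldType} {I : choiceType} {V : lmodType K}.
Variable op : I -> {linear V -> V}.
Implicit Types (x y : {malg K[{fmonom I}]}) (m : {fmonom I}) (v : V).

Definition word_act m v : V := foldr (fun i => op i) v m.

Lemma word_act1 v : word_act mone v = v.
Proof. by rewrite /word_act fm1. Qed.

Lemma word_actU i v : word_act (fmu i) v = op i v.
Proof. by rewrite /word_act fmU. Qed.

Lemma word_actM m1 m2 v : word_act (mmul m1 m2) v = word_act m1 (word_act m2 v).
Proof. by rewrite /word_act fmM foldr_cat. Qed.

Lemma word_act_linear m : linear (word_act m).
Proof.
move=> a u v; rewrite /word_act; elim: (m : seq I) => //= i s ->.
by rewrite linearP.
Qed.

HB.instance Definition _ m := GRing.isLinear.Build K V V *:%R (word_act m)
  (word_act_linear m).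

Definition free_act x v : V := \sum_(m <- msupp x) x@_m *: word_act m v.

Lemma free_actEw (d : {fset {fmonom I}}) x v : (msupp x `<=` d)%fset ->
  free_act x v = \sum_(m <- d) x@_m *: word_act m v.
Proof.
move=> le; rewrite [LHS](big_fset_incl _ le) => //= m md /mcoeff_outdom ->.
by rewrite scale0r.
Qed.

Lemma free_act_linear x : linear (free_act x).
Proof.
move=> a u v; rewrite /free_act scaler_sumr -big_split /=.
by apply: eq_bigr => m _; rewrite linearP scalerDr !scalerA mulrC.
Qed.

HB.instance Definition _ x := GRing.isLinear.Build K V V *:%R (free_act x)
  (free_act_linear x).

Lemma free_actDl x y v : free_act (x + y) v = free_act x v + free_act y v.
Proof.
rewrite (free_actEw _ (msuppD_le _ _)) (free_actEw v (fsubsetUl _ (msupp y))).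
rewrite (free_actEw v (fsubsetUr (msupp x) _)) -big_split /=.
by apply: eq_bigr => m _; rewrite mcoeffD scalerDl.
Qed.

Lemma free_actZl a x v : free_act (a *: x) v = a *: free_act x v.
Proof.
rewrite (free_actEw _ (msuppZ_le _ _)) scaler_sumr.
by apply: eq_bigr => m _; rewrite mcoeffZ scalerA.
Qed.

Lemma free_act0l v : free_act 0 v = 0.
Proof. by have := free_actZl 0 0 v; rewrite !scale0r. Qed.

Lemma free_actBl x y v : free_act (x - y) v = free_act x v - free_act y v.
Proof. by rewrite -(scaleN1r y) free_actDl free_actZl scaleN1r. Qed.

Lemma free_actU a m v : free_act << a *g m >> v = a *: word_act m v.
Proof. by rewrite (free_actEw _ msuppU_le) big_seq_fset1 mcoeffUU. Qed.

Lemma free_act_sum (J : Type) (r : seq J) F v :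
  free_act (\sum_(j <- r) F j) v = \sum_(j <- r) free_act (F j) v.
Proof.
exact: (big_morph (fun x => free_act x v) (fun x y => free_actDl x y v)
  (free_act0l v)).
Qed.

Lemma free_actM x y v : free_act (x * y) v = free_act x (free_act y v).
Proof.
rewrite malgME free_act_sum; apply: eq_bigr => m _.
rewrite free_act_sum linear_sum scaler_sumr; apply: eq_bigr => m' _ /=.
by rewrite free_actU word_actM linearZ scalerA.
Qed.

Lemma free_act1 v : free_act 1 v = v.
Proof. by rewrite free_actU word_act1 scale1r. Qed.

Lemma free_act_ideal (S : {malg K[{fmonom I}]} -> Prop) :
    (forall x, S x -> forall v, free_act x v = 0) ->
  forall x, ideal_gen S x -> forall v, free_act x v = 0.
Proof.
move=> hS x; elim=> {x} [x /hS //|v|x y _ ihx _ ihy v|a x _ ih v|a x _ ih v].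
- by rewrite free_act0l.
- by rewrite free_actBl ihx ihy subr0.
- by rewrite free_actM ih linear0.
- by rewrite free_actM ih.
Qed.

End FreeAlgebraAction.

(* Locked: comparing unfolded products of free_gen's up to conversion diverges. *)
HB.lock Definition free_gen (K : fieldType) (n : nat) (i : 'I_n.-1)
  : {malg K[{fmonom 'I_n.-1}]} := << fmu i >>.

Section HeckeQuotient.
Context (K : fieldType) (n : nat).
Local Notation free := {malg K[{fmonom 'I_n.-1}]}.
Local Notation X := (@free_gen K n).
Implicit Types (i j : 'I_n.-1) (x y : free).

Inductive hecke_relator : free -> Prop :=
| hecke_relator_idem i : hecke_relator (X i * X i - X i)
| hecke_relator_braid i j of j = i.+1 :> nat :
    hecke_relator (X i * X j * X i - X j * X i * X j)
| hecke_relator_comm i j of (i.+1 < j)%N || (j.+1 < i)%N :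
    hecke_relator (X i * X j - X j * X i).

Definition hecke_ideal : {pred free} := fun x => `[< ideal_gen hecke_relator x >].

Fact hecke_ideal_zmod : zmod_closed hecke_ideal.
Proof.
split=> [|x y /asboolP hx /asboolP hy]; apply/asboolP.
  exact: ideal_gen0.
exact: ideal_genB.
Qed.
HB.instance Definition _ := GRing.isZmodClosed.Build free hecke_ideal
  hecke_ideal_zmod.

Definition hecke : Type := Quotient.quot hecke_ideal.
HB.instance Definition _ := EqQuotient.on hecke.
HB.instance Definition _ := Choice.on hecke.
HB.instance Definition _ := GRing.Zmodule.on hecke.

End HeckeQuotient.

HB.lock Definition hecke_pi (K : fieldType) (n : nat)
    (x : {malg K[{fmonom 'I_n.-1}]}) : hecke K n :=
  (\pi_(hecke K n) x)%qT.

HB.lock Definition hecke_mul (K : fieldType) (n : nat) (a b : hecke K n)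
    : hecke K n :=
  hecke_pi (repr a * repr b).

Section Hecke.
Context (K : fieldType) (n : nat).
Local Notation free := {malg K[{fmonom 'I_n.-1}]}.
Local Notation X := (@free_gen K n).
Local Notation hecke := (hecke K n).
Local Notation hecke_relator := (@hecke_relator K n).
Local Notation hecke_pi := (@hecke_pi K n).
Implicit Types (i j : 'I_n.-1) (x y : free).

Lemma hecke_piE x y :
  hecke_pi x = hecke_pi y <-> ideal_gen hecke_relator (x - y).
Proof.
rewrite hecke_pi.unlock; split=> [/eqP|h].
  by rewrite -Quotient.idealrBE => /asboolP.
by apply/eqP; rewrite -Quotient.idealrBE; apply/asboolP.
Qed.

Lemma hecke_piK : cancel (fun a : hecke => repr a) hecke_pi.
Proof. by move=> a; rewrite hecke_pi.unlock reprK. Qed.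

Lemma hecke_piD : {morph hecke_pi : x y / x + y}.
Proof. by rewrite hecke_pi.unlock; exact: Quotient.pi_add. Qed.

Lemma hecke_piN : {morph hecke_pi : x / - x}.
Proof. by rewrite hecke_pi.unlock; exact: Quotient.pi_opp. Qed.

Lemma hecke_pi0 : hecke_pi 0 = 0.
Proof. by rewrite -(subrr 0) hecke_piD hecke_piN subrr. Qed.

Definition hecke_one : hecke := hecke_pi 1.
Local Notation hecke_mul := (@hecke_mul K n).

Lemma hecke_piM : {morph hecke_pi : x y / x * y >-> hecke_mul x y}.
Proof.
move=> x y; rewrite hecke_mul.unlock; apply/hecke_piE.
have -> u v : x * y - u * v = (x - u) * y - u * (v - y) :> free.
  by rewrite mulrBl mulrBr opprB addrA subrK.
by apply: ideal_genB; [apply: ideal_genMr|apply: ideal_genMl];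
  apply/hecke_piE; rewrite hecke_piK.
Qed.

Lemma hecke_mulA : associative hecke_mul.
Proof.
move=> a b c; rewrite -(hecke_piK a) -(hecke_piK b) -(hecke_piK c).
by rewrite -!hecke_piM mulrA.
Qed.

Lemma hecke_mul1 : left_id hecke_one hecke_mul.
Proof. by move=> a; rewrite -(hecke_piK a) -hecke_piM mul1r. Qed.

Lemma hecke_mulr1 : right_id hecke_one hecke_mul.
Proof. by move=> a; rewrite -(hecke_piK a) -hecke_piM mulr1. Qed.

Lemma hecke_mulDl : left_distributive hecke_mul +%R.
Proof.
move=> a b c; rewrite -(hecke_piK a) -(hecke_piK b) -(hecke_piK c).
by rewrite -hecke_piD -!hecke_piM mulrDl hecke_piD.
Qed.

Lemma hecke_mulDr : right_distributive hecke_mul +%R.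
Proof.
move=> a b c; rewrite -(hecke_piK a) -(hecke_piK b) -(hecke_piK c).
by rewrite -hecke_piD -!hecke_piM mulrDr hecke_piD.
Qed.

Section Action.
Context {V : lmodType K}.
Variable op : 'I_n.-1 -> {linear V -> V}.

Definition hecke_relations : Prop :=
  [/\ forall i v, op i (op i v) = op i v,
      forall i j v, j = i.+1 :> nat ->
        op i (op j (op i v)) = op j (op i (op j v))
    & forall i j v, (i.+1 < j)%N -> op i (op j v) = op j (op i v)].

Definition hecke_act (a : hecke) (v : V) : V := free_act op (repr a) v.

Hypothesis op_rel : hecke_relations.

Lemma free_act_relator x : hecke_relator x -> forall v, free_act op x v = 0.
Proof.
have [hi hb hc] := op_rel.
have E i v : free_act op (X i) v = op i v.
  by rewrite free_gen.unlock free_actU scale1r word_actU.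
have M2 i j v : free_act op (X i * X j) v = op i (op j v).
  by rewrite free_actM !E.
have M3 i j k v : free_act op (X i * X j * X k) v = op i (op j (op k v)).
  by rewrite (free_actM op (X i * X j)) M2 E.
case=> [i|i j ij|i j ij] v; rewrite free_actBl.
- by rewrite M2 E hi subrr.
- by apply/eqP; rewrite subr_eq0; apply/eqP/(etrans (M3 _ _ _ _));
    apply/(etrans (hb _ _ _ ij))/esym/M3.
apply/eqP; rewrite subr_eq0; apply/eqP/(etrans (M2 _ _ _))/esym/(etrans (M2 _ _ _)).
by case/orP: ij => ij; rewrite (hc _ _ _ ij).
Qed.

Lemma hecke_act_pi x v : hecke_act (hecke_pi x) v = free_act op x v.
Proof.
apply/eqP; rewrite -subr_eq0 -free_actBl; apply/eqP.
apply: (free_act_ideal (S := hecke_relator)); first exact: free_act_relator.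
by apply/hecke_piE; rewrite hecke_piK.
Qed.

Lemma hecke_actA a b v :
  hecke_act a (hecke_act b v) = hecke_act (hecke_mul a b) v.
Proof. by rewrite hecke_mul.unlock hecke_act_pi free_actM. Qed.

Lemma hecke_act1 v : hecke_act hecke_one v = v.
Proof. by rewrite hecke_act_pi free_act1. Qed.

Lemma hecke_actDr : right_distributive hecke_act +%R.
Proof. by move=> a u v; rewrite /hecke_act linearD. Qed.

Lemma hecke_actDl v : {morph hecke_act^~ v : a b / a + b}.
Proof.
move=> a b; rewrite -(hecke_piK a) -(hecke_piK b) -hecke_piD.
by rewrite !hecke_act_pi free_actDl.
Qed.

End Action.

Lemma hecke_one_neq0 : hecke_one != 0.
Proof.
apply/eqP=> e; pose op (i : 'I_n.-1) : {linear K^o -> K^o} := \0.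
have rel : hecke_relations op by split.
have := oner_neq0 K; rewrite -[X in X != _](hecke_act1 rel) e -hecke_pi0.
by rewrite (hecke_act_pi rel) free_act0l eqxx.
Qed.

HB.instance Definition _ := GRing.Zmodule_isNzRing.Build hecke
  hecke_mulA hecke_mul1 hecke_mulr1 hecke_mulDl hecke_mulDr hecke_one_neq0.

Lemma hecke_pi_is_monoid_morphism : monoid_morphism hecke_pi.
Proof. by split=> // x y; apply: hecke_piM. Qed.

Lemma hecke_pi_is_zmod_morphism : zmod_morphism hecke_pi.
Proof. by move=> x y; rewrite hecke_piD hecke_piN. Qed.

HB.instance Definition _ := GRing.isZmodMorphism.Build free hecke hecke_pi
  hecke_pi_is_zmod_morphism.
HB.instance Definition _ := GRing.isMonoidMorphism.Build free hecke hecke_pi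
  hecke_pi_is_monoid_morphism.

Definition hecke_scale (c : K) (a : hecke) : hecke := hecke_pi c%:A * a.

Lemma hecke_scaleA c d a :
  hecke_scale c (hecke_scale d a) = hecke_scale (c * d) a.
Proof.
have e : c%:A * d%:A = (c * d)%:A :> free by rewrite -scalerAl mul1r scalerA.
apply: (etrans (mulrA _ _ _)); congr (_ * a).
exact: (etrans (esym (hecke_piM _ _)) (congr1 hecke_pi e)).
Qed.

Lemma hecke_scale1 : left_id 1 hecke_scale.
Proof. by move=> a; rewrite /hecke_scale scale1r rmorph1 mul1r. Qed.

Lemma hecke_scaleDr : right_distributive hecke_scale +%R.
Proof. by move=> c a b; rewrite /hecke_scale mulrDr. Qed.

Lemma hecke_scaleDl a : {morph hecke_scale^~ a : c d / c + d}.
Proof. by move=> c d; rewrite /hecke_scale scalerDl rmorphD mulrDl. Qed.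

HB.instance Definition _ := GRing.Zmodule_isLmodule.Build K hecke
  hecke_scaleA hecke_scale1 hecke_scaleDr hecke_scaleDl.

Lemma hecke_scaleAl c (a b : hecke) : c *: (a * b) = (c *: a) * b.
Proof. exact: mulrA. Qed.

HB.instance Definition _ := GRing.Lmodule_isLalgebra.Build K hecke
  hecke_scaleAl.

Lemma free_scaleAr c x y : c *: (x * y) = x * (c *: y).
Proof.
have e : malgC c * x = x * malgC c.
  rewrite !malgM_def fgmulUg fgmulgU; apply: eq_bigr => m _.
  by rewrite mul1m mulm1 mulrC.
apply: (etrans (esym (mul_malgC c (x * y)))).
apply: (etrans (mulrA _ _ _)); apply: (etrans (congr1 ( *%R^~ y) e)).
apply: (etrans (esym (mulrA x _ y))); congr (x * _); exact: mul_malgC.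
Qed.

Lemma hecke_piZ c x : hecke_pi (c *: x) = c *: hecke_pi x.
Proof. by rewrite -[x in LHS]mul1r scalerAl rmorphM. Qed.

Lemma hecke_scaleAr c (a b : hecke) : c *: (a * b) = a * (c *: b).
Proof.
rewrite -(hecke_piK a) -(hecke_piK b) -rmorphM -!hecke_piZ -rmorphM /=.
by rewrite free_scaleAr.
Qed.

HB.instance Definition _ := GRing.Lalgebra_isAlgebra.Build K hecke
  hecke_scaleAr.

Definition hecke_gen i : hecke := hecke_pi (X i).
Definition hecke_bar_gen i : hecke := hecke_gen i - 1.

Definition hecke_elt (s : 'S_n) : hecke :=
  \prod_(i <- reduced_word s) hecke_gen i.
Definition hecke_bar_elt (s : 'S_n) : hecke :=
  \prod_(i <- reduced_word s) hecke_bar_gen i.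

Lemma hecke_gen_idem i : hecke_gen i * hecke_gen i = hecke_gen i.
Proof.
rewrite -rmorphM /=; apply/hecke_piE/ideal_gen_incl; exact: hecke_relator_idem.
Qed.

Lemma hecke_gen_braid i j : j = i.+1 :> nat ->
  hecke_gen i * hecke_gen j * hecke_gen i =
  hecke_gen j * hecke_gen i * hecke_gen j.
Proof.
move=> ij; rewrite -!rmorphM /=; apply/hecke_piE/ideal_gen_incl.
exact: hecke_relator_braid.
Qed.

Lemma hecke_gen_comm i j : (i.+1 < j)%N || (j.+1 < i)%N ->
  hecke_gen i * hecke_gen j = hecke_gen j * hecke_gen i.
Proof.
move=> ij; rewrite -!rmorphM /=; apply/hecke_piE/ideal_gen_incl.
exact: hecke_relator_comm.
Qed.

Lemma hecke_act_gen (V : lmodType K) (op : 'I_n.-1 -> {linear V -> V}) i v :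
  hecke_relations op -> hecke_act op (hecke_gen i) v = op i v.
Proof. by move=> h; rewrite hecke_act_pi // free_gen.unlock free_actU scale1r word_actU. Qed.

Lemma hecke_bar_gen_braid i j : j = i.+1 :> nat ->
  hecke_bar_gen i * hecke_bar_gen j * hecke_bar_gen i =
  hecke_bar_gen j * hecke_bar_gen i * hecke_bar_gen j.
Proof.
move=> ij; rewrite /hecke_bar_gen.
have E (x y : hecke) : x * x = x ->
    (x - 1) * (y - 1) * (x - 1) = x * y * x - (x * y + y * x) + (x + y) - 1.
  move=> xx; rewrite mulrBr mulr1 !mulrBl !mulrBr !mul1r !mulr1 !mulrBl xx mul1r.
  by rewrite !opprB opprD !addrA subrK [LHS](ACl (1*6*2*5*3*4)).
rewrite !E ?hecke_gen_idem // hecke_gen_braid //.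
by rewrite [_ * _ + _ * _]addrC [hecke_gen i + _]addrC.
Qed.

Lemma hecke_bar_gen_comm i j : (i.+1 < j)%N || (j.+1 < i)%N ->
  hecke_bar_gen i * hecke_bar_gen j = hecke_bar_gen j * hecke_bar_gen i.
Proof.
move=> ij; rewrite /hecke_bar_gen !mulrBr !mulr1 !mulrBl !mul1r.
by rewrite hecke_gen_comm // !opprB !addrA [LHS](ACl (1*4*3*2)).
Qed.

(* hecke_elt and hecke_bar_elt do not depend on the chosen reduced word. *)
Lemma hecke_elt_word w : reduced w ->
  hecke_elt (word_perm w) = \prod_(i <- w) hecke_gen i.
Proof.
move=> rw; have [e1 e2] := reduced_wordP (word_perm w).
apply: braid_prod => //; [exact: hecke_gen_braid|exact: hecke_gen_comm|].
by rewrite /reduced e1 e2.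
Qed.

Lemma hecke_bar_elt_word w : reduced w ->
  hecke_bar_elt (word_perm w) = \prod_(i <- w) hecke_bar_gen i.
Proof.
move=> rw; have [e1 e2] := reduced_wordP (word_perm w).
apply: braid_prod => //; [exact: hecke_bar_gen_braid|exact: hecke_bar_gen_comm|].
by rewrite /reduced e1 e2.
Qed.

Lemma hecke_act_scalar (V : lmodType K) (op : 'I_n.-1 -> {linear V -> V}) c v :
  hecke_relations op -> hecke_act op c%:A v = c *: v.
Proof.
move=> h; have -> : c%:A = hecke_pi c%:A :> hecke by rewrite hecke_piZ.
by rewrite hecke_act_pi // free_actZl free_act1.
Qed.

End Hecke.

Definition lmod_iso (A : nzRingType) (U V : lmodType A) : Prop :=
  exists f : {linear U -> V}, bijective f.

Section LeftIdeal.
Context {A : nzRingType} (e : A).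

Definition in_left_ideal : {pred A^o} := fun x => `[< exists a : A, x = a * e >].

Fact in_left_ideal_submod : submod_closed in_left_ideal.
Proof.
split=> [|a x y /asboolP[b ->] /asboolP[c ->]]; apply/asboolP.
  by exists 0; rewrite mul0r.
by exists (a * b + c); rewrite mulrDl -mulrA.
Qed.

HB.instance Definition _ := GRing.isSubmodClosed.Build A A^o in_left_ideal
  in_left_ideal_submod.

Record left_ideal := LeftIdeal {
  left_ideal_val :> A^o;
  left_idealP : left_ideal_val \in in_left_ideal
}.

HB.instance Definition _ := [isSub for left_ideal_val].
HB.instance Definition _ := [Choice of left_ideal by <:].
HB.instance Definition _ := [SubChoice_isSubLmodule of left_ideal by <:].

End LeftIdeal.

(* The line K v_alpha; alpha is kept as an index since the action depends on it. *)
Definition Fmod (K : fieldType) n (alpha : composition n) : Type := K^o.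

Section Modules.
Context (K : fieldType) {n : nat}.

Definition Pmod (alpha : composition n) : lmodType (hecke K n) :=
  left_ideal (hecke_elt K (w0_comp (comp_compl alpha))
              * hecke_bar_elt K (w0_comp alpha)).

Section OneDimensional.
Variable alpha : composition n.

Definition Fmod_op (i : 'I_n.-1) : {linear K^o -> K^o} :=
  if i \in comp_set alpha then \0 : {linear _ -> _} else idfun : {linear _ -> _}.

Fact Fmod_rel : hecke_relations Fmod_op.
Proof.
split=> [i v|i j v _|i j v _]; rewrite /Fmod_op.
- by case: ifP.
- by do 2!case: ifP.
- by do 2!case: ifP.
Qed.

Local Notation Fmod := (Fmod K alpha).
HB.instance Definition _ := GRing.Zmodule.copy Fmod K^o.

Fact Fmod_scaleA a b (v : Fmod) :
  hecke_act Fmod_op a (hecke_act Fmod_op b v) = hecke_act Fmod_op (a * b) v.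
Proof. exact: hecke_actA Fmod_rel _ _ _. Qed.

HB.instance Definition _ := GRing.Zmodule_isLmodule.Build (hecke K n) Fmod
  Fmod_scaleA (hecke_act1 Fmod_rel) (hecke_actDr Fmod_op)
  (hecke_actDl Fmod_rel).

Lemma Fmod_genE i (v : Fmod) :
  hecke_gen K i *: v = if i \in comp_set alpha then 0 else v.
Proof.
rewrite [LHS]hecke_act_gen; last exact: Fmod_rel.
by rewrite /Fmod_op; case: ifP.
Qed.

Lemma Fmod_scalarE (c : K) (v : Fmod) :
  (c%:A : hecke K n) *: v = (c * v : K^o).
Proof. exact/hecke_act_scalar/Fmod_rel. Qed.

End OneDimensional.

Section WeakBruhatInterval.
Variables sigma rho : 'S_n.
Local Notation itv := {g : 'S_n | g \in itvL sigma rho}.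
Implicit Types (g : itv) (f : {ffun itv -> K^o}).

Definition bvec g : {ffun itv -> K^o} := [ffun h => (h == g)%:R].

Definition Bmod_gen (i : 'I_n.-1) g : {ffun itv -> K^o} :=
  if i \in DesL (val g) then bvec g
  else if insub (simple i \oS val g) is Some h then bvec h
  else 0.

Definition Bmod_op_fun i f : {ffun itv -> K^o} :=
  \sum_(g : itv) f g *: Bmod_gen i g.

Fact Bmod_op_linear i : linear (Bmod_op_fun i).
Proof.
move=> a f1 f2; rewrite /Bmod_op_fun scaler_sumr -big_split /=.
by apply: eq_bigr => g _; rewrite !ffunE scalerDl scalerA.
Qed.

HB.instance Definition _ i := GRing.isLinear.Build K {ffun itv -> K^o}
  {ffun itv -> K^o} *:%R (Bmod_op_fun i) (Bmod_op_linear i).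

Definition Bmod_op i : {linear {ffun itv -> K^o} -> {ffun itv -> K^o}} :=
  Bmod_op_fun i.

Lemma bvec_sum f : f = \sum_(g : itv) f g *: bvec g.
Proof.
apply/ffunP=> h; rewrite sum_ffunE (bigD1 h) //= big1 ?addr0 => [|g gh].
  by rewrite !ffunE eqxx; apply/esym/mulr1.
by rewrite !ffunE eq_sym (negPf gh) scaler0.
Qed.

Lemma Bmod_op_bvec i g : Bmod_op i (bvec g) = Bmod_gen i g.
Proof.
rewrite /= /Bmod_op_fun (bigD1 g) //= big1 ?addr0 => [|h hg].
  by rewrite ffunE eqxx scale1r.
by rewrite ffunE (negPf hg) scale0r.
Qed.

Definition bvec_opt (s : 'S_n) : {ffun itv -> K^o} :=
  if insub s is Some h then bvec h else 0.

Lemma Bmod_genE i g : Bmod_gen i g = bvec_opt (dem i (val g)).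
Proof. by rewrite /Bmod_gen /bvec_opt /dem; case: ifP => //; rewrite valK. Qed.

Lemma Bmod_op_opt i s : weakL sigma s ->
  Bmod_op i (bvec_opt s) = bvec_opt (dem i s).
Proof.
move=> ss; rewrite {1}/bvec_opt; case: insubP => [g _ <-|].
  by rewrite Bmod_op_bvec Bmod_genE.
rewrite linear0 inE ss /= => nr; rewrite /bvec_opt insubF // inE.
apply/negbTE; rewrite negb_and; apply/orP; right.
by apply: contraNN nr; apply: weakL_trans; apply: dem_weakL.
Qed.

Fact Bmod_rel : hecke_relations Bmod_op.
Proof.
have wd i s : weakL sigma s -> weakL sigma (dem i s).
  by move/weakL_trans; apply; apply: dem_weakL.
have ext (F G : {linear {ffun itv -> K^o} -> {ffun itv -> K^o}}) :
    (forall s, weakL sigma s -> F (bvec_opt s) = G (bvec_opt s)) -> F =1 G.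
  move=> FG f; rewrite (bvec_sum f) !linear_sum; apply: eq_bigr => g _.
  rewrite !linearZ /=; congr (_ *: _).
  have -> : bvec g = bvec_opt (val g) by rewrite /bvec_opt valK.
  by apply: FG; have := valP g; rewrite inE => /andP[].
split=> [i v|i j v ij|i j v ij].
- apply: (ext (Bmod_op i \o Bmod_op i) (Bmod_op i)) v => s ss /=.
  by rewrite !Bmod_op_opt ?wd // dem_idem.
- apply: (ext (Bmod_op i \o (Bmod_op j \o Bmod_op i))
    (Bmod_op j \o (Bmod_op i \o Bmod_op j))) v => s ss /=.
  by rewrite !Bmod_op_opt ?wd // (dem_braid _ ij).
- apply: (ext (Bmod_op i \o Bmod_op j) (Bmod_op j \o Bmod_op i)) v => s ss /=.
  by rewrite !Bmod_op_opt ?wd // (dem_comm _ ij).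
Qed.

(* As for Fmod, the K-vector space structure is recovered from the hecke-module
   structure through the scalars c%:A, see Bmod_scalarE. *)
Definition Bmod : Type := {ffun itv -> K^o}.
HB.instance Definition _ := GRing.Zmodule.on Bmod.

Fact Bmod_scaleA a b (v : Bmod) :
  hecke_act Bmod_op a (hecke_act Bmod_op b v) = hecke_act Bmod_op (a * b) v.
Proof. exact: hecke_actA Bmod_rel _ _ _. Qed.

HB.instance Definition _ := GRing.Zmodule_isLmodule.Build (hecke K n) Bmod
  Bmod_scaleA (hecke_act1 Bmod_rel) (hecke_actDr Bmod_op)
  (hecke_actDl Bmod_rel).

Lemma Bmod_scale_gen i g : hecke_gen K i *: (bvec g : Bmod) = Bmod_gen i g.
Proof. by rewrite [LHS]hecke_act_gen ?Bmod_op_bvec //; apply: Bmod_rel. Qed.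

Lemma Bmod_scalarE (c : K) (f : Bmod) :
  (c%:A : hecke K n) *: f = (c *: (f : {ffun itv -> K^o}) : {ffun itv -> K^o}).
Proof. exact/hecke_act_scalar/Bmod_rel. Qed.

End WeakBruhatInterval.

End Modules.

(* Main.v *)
Require Import Defs.
From HB Require Import structures.
From mathcomp Require Import all_boot all_order all_fingroup all_algebra.
From mathcomp Require Import generic_quotient ring_quotient finmap monalg.
From mathcomp Require Import boolp reals complex.
From mathcomp Require Import zify.

Set Implicit Arguments.
Unset Strict Implicit.
Unset Printing Implicit Defensive.

Import GRing.Theory.
Local Open Scope ring_scope.

(** Let D be the set of the composition, W_D the subgroup generated by the s_i
with i in D, and w_D its longest element. Write sigma for the longest element
attached in the same way to the complement of D, rho for w0 w_D, and e_D for
the bar-pi of w_D.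

For the projective module, the candidate isomorphism goes from the interval
module to the left ideal and sends g to pi_g e_D. Two facts make it linear over
the Hecke algebra. First, pi_i pi_g = pi_(dem i g), which is the rule of the
interval module as long as dem i g stays below rho. Second, when s is not below
rho, some right descent d of s lies in D (not_weakL_desc); then pi_s ends with
pi_d while e_D begins with bar-pi_d, and pi_d bar-pi_d = 0, so pi_s e_D = 0.
The map reaches the generator pi_sigma e_D of the ideal, hence is surjective.
For injectivity, let the ideal act on the identity permutation in the interval
module of [1, rho]. There pi_s maps 1 to s, or to 0 if s is not below rho
(hecke_elt_bvec_opt), whereas every pi_d with d in D kills 1 because s_d is not
below rho; so bar-pi_d acts on 1 by -1, and e_D by a sign
(hecke_bar_elt_bvec_opt). Thus pi_g e_D sends 1 to plus or minus g, and these
vectors are independent.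

For the one-dimensional module, the interval is the single permutation sigma,
whose left descents are the complement of D (w0_par_desc), so that pi_i acts on
it by 0 or 1 exactly as prescribed.

The combinatorial input is a criterion for the weak order through inclusion of
inversions (weakL_inversions) and the fact that W_D permutes separately the
blocks of points cut out by the complement of D (parabolic_stable). *)

(** * Length and weak order *)

Section Length.
Context {n : nat}.
Implicit Types (i : 'I_n.-1) (s t r : 'S_n) (w : seq 'I_n.-1).

Lemma len_simple_asc i s : ~~ desc i s -> len (simple i \oS s) = (len s).+1.
Proof. by move=> a; rewrite (@len_simple_desc _ i) ?simpleK ?desc_simple. Qed.

Lemma simple_invol i : (simple i)^-1%g = simple i.
Proof. exact: tpermV. Qed.

Lemma word_perm_rev w : word_perm (rev w) = (word_perm w)^-1%g.
Proof.
elim: w => [|i w ih]; first by rewrite invg1.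
rewrite rev_cons -cats1 word_perm_cat ih /= /perm_comp invMg simple_invol.
by rewrite mul1g.
Qed.

Lemma len_inv s : len s^-1%g = len s.
Proof.
have le t : (len t^-1%g <= len t)%N.
  have [e1 <-] := reduced_wordP t.
  by rewrite -{1}e1 -word_perm_rev -(size_rev (reduced_word t)) len_word.
by apply/eqP; rewrite eqn_leq le -{1}[s]invgK le.
Qed.

(** A left descent of the inverse is a right descent: all right descents below
are expressed in this form. *)
Lemma descV i s : desc i s^-1%g = (s (ord_hi i) < s (ord_lo i))%N.
Proof. by rewrite /desc invgK. Qed.

Lemma weakL_comp s t : len (s \oS t) = (len s + len t)%N -> weakL t (s \oS t).
Proof. by move=> e; apply/existsP; exists s; rewrite eqxx e /=. Qed.

Lemma weakL_refl s : weakL s s.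
Proof. by have := @weakL_comp 1%g s; rewrite perm_comp1s len1; apply. Qed.

Lemma weakL1 s : weakL 1%g s.
Proof.
have e : s \oS 1%g = s by rewrite /perm_comp mul1g.
by have := @weakL_comp s 1%g; rewrite e len1 addn0; apply.
Qed.

(** Were s increasing at each step from x to y, it would be increasing from x
to y. *)
Lemma desc_between s (x y : 'I_n) : (x < y)%N -> (s y < s x)%N ->
  exists i, [/\ (x <= i)%N, (i < y)%N & desc i s^-1%g].
Proof.
have [k] := ubnP (y - x); elim: k y => // k ih y le xy lt.
have y1 : (y.-1 < n.-1)%N by have := ltn_ord y; lia.
pose i := Ordinal y1; have ey : y = ord_hi i by apply: val_inj => /=; lia.
have [d|] := boolP (desc i s^-1%g); first by exists i; split=> //=; lia.
rewrite descV -ey -leqNgt => up.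
have [xi|xi] := eqVneq x (ord_lo i); first by move: lt up; rewrite xi; lia.
have {}xi : (x < y.-1)%N by move: xi; rewrite -val_eqE /=; lia.
have [|||j [h1 h2 h3]] := ih (ord_lo i) => //=; [lia|lia|].
by exists j; split=> //; move: h2 => /=; lia.
Qed.

(** Climb from s to r by left ascents. If s differs from r, the permutation
that takes s to r has a right descent i; let y and x be the points that s maps
to i and i + 1, so that r maps x below y. If x came first, s would invert the
two points and r would not, against the inclusion; hence y comes first, r
inverts the pair, and multiplying s by s_i adds just this inversion and
preserves the hypothesis. *)
Lemma weakL_inversions s r :
    (forall x y : 'I_n, (x < y)%N -> (s y < s x)%N -> (r y < r x)%N) ->
  weakL s r.
Proof.
(* Lengths are bounded by the number of pairs, so the climb terminates. *)
have [k] := ubnP (#|{: 'I_n * 'I_n}| - len s); elim: k s => // k ih s le sub.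
have [/forallP nd|] := boolP [forall i, ~~ desc i (r \oS s^-1)^-1%g].
  suff -> : r = s by apply: weakL_refl.
  have /eqP := no_desc_id nd; rewrite invg_eq1 => /eqP e.
  by apply/permP=> x; have /permP/(_ (s x)) := e; rewrite perm_compE permK perm1.
case/forallPn=> i /negPn; rewrite descV !perm_compE.
set x := (s^-1)%g _; set y := (s^-1)%g _ => lt.
have sy : s y = ord_lo i by rewrite permKV.
have sx : s x = ord_hi i by rewrite permKV.
have asc : ~~ desc i s.
  rewrite -asc_desc -/x -/y ltnNge; apply/negP; rewrite leq_eqVlt.
  case/orP=> [/eqP/val_inj exy|xy]; first by rewrite exy ltnn in lt.
  by have := sub x y xy; rewrite sx sy /= ltnSn => /(_ isT); lia.
apply: weakL_trans (ih (simple i \oS s) _ _).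
- by have := dem_weakL i s; rewrite demE (negPf asc).
- have : (len (simple i \oS s) <= #|{: 'I_n * 'I_n}|)%N.
    by rewrite len_inversions max_card.
  by move: le; rewrite (len_simple_asc asc); lia.
move=> a b ab; rewrite !perm_compE => lt2.
(* A pair inverted by s_i s is inverted by s or is the added pair y, x. *)
case: (ltngtP (s b) (s a)) => [lt3|lt3|/val_inj/perm_inj eab].
- exact: sub.
- move: lt3.
  have [[ea eb]|/simple_lt h /h] := eqVneq (s a, s b) (ord_lo i, ord_hi i).
    have -> : b = x by apply: (@perm_inj _ s); rewrite sx.
    by have -> : a = y by apply: (@perm_inj _ s); rewrite sy.
  by lia.
- by rewrite eab ltnn in ab.
Qed.

End Length.

(** * Longest elements of parabolic subgroups *)

Section LongestElements.
Context {n : nat}.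
Implicit Types (i : 'I_n.-1) (s t r : 'S_n) (w : seq 'I_n.-1).
Implicit Types D : {set 'I_n.-1}.

Local Notation parabolic D := <<[set simple i | i in D]>>%g.

Lemma simple_parabolic D i : i \in D -> simple i \in parabolic D.
Proof. by move=> iD; rewrite mem_gen ?imset_f. Qed.

(** Each generator s_d with d in D exchanges two points lying on the same side
of the cut after position i. *)
Lemma parabolic_stable D s i (x : 'I_n) :
  s \in parabolic D -> i \notin D -> (s x <= i)%N = (x <= i)%N.
Proof.
move=> + iD; case/gen_prodgP=> k [c cD ->]; move: x.
elim/big_ind: _ => [x|t r ht hr x|j _ x]; first by rewrite perm1.
  by rewrite permM hr ht.
have /imsetP[d dD ->] := cD j.
have : i != d by apply: contraNneq iD => ->.
by rewrite /simple; case: tpermP => [->|->|//]; rewrite -val_eqE /=; lia.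
Qed.

Lemma parabolic_desc D s i : s \in parabolic D -> desc i s -> i \in D.
Proof.
move=> sD d; apply: contraLR (d) => iD; rewrite -asc_desc.
have sV : s^-1%g \in parabolic D by rewrite groupV.
have := parabolic_stable (ord_lo i) sV iD.
have := parabolic_stable (ord_hi i) sV iD.
by rewrite /= ltnn leqnn; lia.
Qed.

Lemma parabolic_word D w :
  reduced w -> word_perm w \in parabolic D -> all [in D] w.
Proof.
elim: w => //= i w ih /reduced_cons[rw d] iwD.
have iD := parabolic_desc iwD d; rewrite iD ih //.
by rewrite -(simpleK i (word_perm w)) /perm_comp groupMr ?simple_parabolic.
Qed.

Lemma w0_par_mem D : w0_par D \in parabolic D.
Proof. by rewrite /w0_par; case: arg_maxnP => //; apply: group1. Qed.

Lemma w0_par_max D s : s \in parabolic D -> (len s <= len (w0_par D))%N.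
Proof.
by rewrite /w0_par; case: arg_maxnP => [|t _ max]; [apply: group1|apply: max].
Qed.

Lemma w0_par_desc D i : desc i (w0_par D) = (i \in D).
Proof.
apply/idP/idP => [|iD]; first exact/parabolic_desc/w0_par_mem.
apply/negPn/negP=> /len_simple_asc e.
have := @w0_par_max D (simple i \oS w0_par D).
by rewrite e ltnn groupMl ?w0_par_mem ?simple_parabolic // => /(_ isT).
Qed.

(** For i in D, a right ascent at i would give a longer element of the
parabolic subgroup, by length invariance under inversion. *)
Lemma w0_par_descV D i : i \in D -> desc i (w0_par D)^-1%g.
Proof.
move=> iD; apply/negPn/negP=> /len_simple_asc e.
have := @w0_par_max D (simple i \oS (w0_par D)^-1%g).
rewrite e len_inv ltnn groupMl ?groupV ?w0_par_mem ?simple_parabolic //.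
by move=> /(_ isT).
Qed.

(** A cut outside D keeps its two sides stable, so that only points of the same
block can be inverted. *)
Lemma w0_par_block D (x y : 'I_n) i : (w0_par D y < w0_par D x)%N ->
  (x <= i)%N -> (i < y)%N -> i \in D.
Proof.
move=> lt xi iy; apply/negPn/negP=> iD.
have := parabolic_stable x (w0_par_mem D) iD.
by have := parabolic_stable y (w0_par_mem D) iD; lia.
Qed.

(** By maximality every position is a right descent of w0. *)
Lemma w0_antitone (x y : 'I_n) : (x < y)%N -> (w0 y < w0 x)%N.
Proof.
have d i : desc i w0^-1%g.
  apply/negPn/negP=> /len_simple_asc.
  have : (len (simple i \oS w0^-1) <= len (@w0 n))%N.
    by rewrite /w0; case: arg_maxnP => // t _; apply.
  by rewrite len_inv => + e; rewrite e ltnn.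
have [k] := ubnP (y - x); elim: k y => // k ih y le xy.
have y1 : (y.-1 < n.-1)%N by have := ltn_ord y; lia.
pose i := Ordinal y1; have ey : y = ord_hi i by apply: val_inj => /=; lia.
have := d i; rewrite descV -ey.
have [->//|xi] := eqVneq x (ord_lo i).
move=> /ltn_trans; apply; apply: ih; rewrite /=; first by lia.
by move: xi; rewrite -val_eqE /=; lia.
Qed.

Lemma w0_lt (x y : 'I_n) : (w0 x < w0 y)%N = (y < x)%N.
Proof.
case: (ltngtP y x) => [/w0_antitone->//|/w0_antitone|/val_inj ->]; lia.
Qed.

(** If s increases along every block of D, its inversions join distinct blocks;
the longest element of W_D preserves the order of such a pair and w0 then
reverses it, so the inversions of s are among those of the upper bound. *)
Lemma not_weakL_desc D s : ~~ weakL s (w0 \oS w0_par D) ->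
  exists2 d, d \in D & desc d s^-1%g.
Proof.
move=> nle; apply/exists_inP; apply: contraNT nle => /exists_inPn nd.
apply: weakL_inversions => x y xy lt; rewrite !perm_compE w0_lt ltnNge.
apply/negP=> le; have [i [xi iy di]] := desc_between xy lt.
suff iD : i \in D by have := nd i iD; rewrite di.
apply: w0_par_block xi iy; rewrite ltn_neqAle le andbT.
by apply/eqP=> /val_inj/perm_inj e; rewrite e ltnn in xy.
Qed.

Lemma weakL_w0_par D : weakL (w0_par (~: D)) (w0 \oS w0_par D).
Proof.
apply: contraT => /not_weakL_desc[d dD]; rewrite descV => /w0_par_block.
by move/(_ d (leqnn _) (ltnSn _)); rewrite inE dD.
Qed.

(** The upper bound has no right descent in D: there the longest element of W_D
has one and w0 reverses it. *)
Lemma simple_not_weakL D i : i \in D -> ~~ weakL (simple i) (w0 \oS w0_par D).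
Proof.
move=> iD; apply/negP=> /existsP[g /andP[/eqP e /eqP l]].
have {e}eg : g^-1%g = simple i \oS (w0 \oS w0_par D)^-1%g.
  by rewrite e /perm_comp invMg simple_invol -mulgA tperm2 mulg1.
have := w0_par_descV iD; rewrite descV -w0_lt -!perm_compE => up.
have : ~~ desc i (w0 \oS w0_par D)^-1%g by rewrite descV -leqNgt ltnW.
move/len_simple_asc; rewrite -eg !len_inv l len_simple; lia.
Qed.

End LongestElements.

(** * Modules over the Hecke algebra *)

Lemma lmod_iso_sym (A : nzRingType) (U V : lmodType A) :
  lmod_iso U V -> lmod_iso V U.
Proof.
case=> f [g fK gK]; have gl : linear g.
  by move=> a u v; apply: (can_inj fK); rewrite gK linearP /= !gK.
pose gL : {linear V -> U} := HB.pack g (GRing.isLinear.Build A V U *:%R g gl).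
by exists gL; exists f.
Qed.

Section HeckeElements.
Context (K : fieldType) {n : nat}.
Implicit Types (i : 'I_n.-1) (s t : 'S_n) (w : seq 'I_n.-1).
Implicit Types a b : hecke K n.

(** The monomials of the free algebra are the words in the generators, and
their images span the quotient. *)
Lemma hecke_ind (P : hecke K n -> Prop) :
    (forall c : K, P c%:A) -> (forall a b, P a -> P b -> P (a + b)) ->
    (forall i a, P a -> P (hecke_gen K i * a)) ->
  forall a, P a.
Proof.
move=> Pc PD Pg a; rewrite -(hecke_piK a).
have P0 : P 0 by rewrite -(scale0r (1 : hecke K n)).
rewrite [X in hecke_pi X]monalgE raddf_sum /=.
apply: big_ind => // m _; move: (mcoeff _ _) => c {a}.
suff h (w : seq 'I_n.-1) : P (hecke_pi << c *g FMonom w >>).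
  by case: m => w.
elim: w => [|i w ih].
  have -> : << c *g FMonom [::] >> = c%:A :> {malg K[{fmonom 'I_n.-1}]}.
    rewrite -mul_malgC mulr1; congr (mkmalgU _ _).
    by apply: val_inj; rewrite /= fm1.
  by rewrite hecke_piZ.
have -> : << c *g FMonom (i :: w) >> = free_gen K i * << c *g FMonom w >>.
  rewrite free_gen.unlock malgM_def fgmulUU mul1r; congr (mkmalgU _ _).
  by apply: val_inj; rewrite /= fmM fmU.
by rewrite rmorphM; apply: Pg.
Qed.

Lemma hecke_elt_comp s t : len (s \oS t) = (len s + len t)%N ->
  hecke_elt K (s \oS t) = hecke_elt K s * hecke_elt K t.
Proof.
have [es ls] := reduced_wordP s; have [et lt] := reduced_wordP t.
move=> e; rewrite -{1}es -{1}et -word_perm_cat hecke_elt_word ?big_cat //.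
by rewrite /reduced word_perm_cat es et size_cat ls lt e.
Qed.

Lemma hecke_bar_elt_comp s t : len (s \oS t) = (len s + len t)%N ->
  hecke_bar_elt K (s \oS t) = hecke_bar_elt K s * hecke_bar_elt K t.
Proof.
have [es ls] := reduced_wordP s; have [et lt] := reduced_wordP t.
move=> e; rewrite -{1}es -{1}et -word_perm_cat hecke_bar_elt_word ?big_cat //.
by rewrite /reduced word_perm_cat es et size_cat ls lt e.
Qed.

Lemma word_perm1 i : word_perm [:: i] = simple i.
Proof. by rewrite /= /perm_comp mul1g. Qed.

Lemma hecke_elt_simple i : hecke_elt K (simple i) = hecke_gen K i.
Proof.
rewrite -word_perm1 hecke_elt_word ?big_seq1 //.
by rewrite /reduced word_perm1 len_simple.
Qed.

Lemma hecke_bar_elt_simple i : hecke_bar_elt K (simple i) = hecke_bar_gen K i.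
Proof.
rewrite -word_perm1 hecke_bar_elt_word ?big_seq1 //.
by rewrite /reduced word_perm1 len_simple.
Qed.

Lemma hecke_gen_elt i s :
  hecke_gen K i * hecke_elt K s = hecke_elt K (dem i s).
Proof.
have asc t : ~~ desc i t ->
    hecke_elt K (simple i \oS t) = hecke_gen K i * hecke_elt K t.
  move=> a; rewrite hecke_elt_comp ?hecke_elt_simple //.
  by rewrite len_simple_asc ?len_simple.
rewrite demE; have [d|/asc-> //] := boolP (desc i s).
have := asc (simple i \oS s); rewrite desc_simple d simpleK => -> //.
by rewrite mulrA hecke_gen_idem.
Qed.

Lemma hecke_elt_gen i s : desc i s^-1%g ->
  hecke_elt K s = hecke_elt K (s \oS simple i) * hecke_gen K i.
Proof.
move=> d; have eV : (s \oS simple i)^-1%g = simple i \oS s^-1%g.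
  by rewrite /perm_comp invMg simple_invol.
rewrite -hecke_elt_simple -hecke_elt_comp.
  by rewrite -perm_compA /perm_comp tperm2 mul1g.
rewrite -perm_compA {1}/perm_comp [_ \oS simple i]tperm2 mul1g len_simple addn1.
by rewrite -len_inv (len_simple_desc d) -eV len_inv.
Qed.

Lemma hecke_bar_elt_desc i s : desc i s ->
  hecke_bar_elt K s = hecke_bar_gen K i * hecke_bar_elt K (simple i \oS s).
Proof.
move=> d; rewrite -hecke_bar_elt_simple -hecke_bar_elt_comp ?simpleK //.
by rewrite len_simple (len_simple_desc d).
Qed.

Lemma hecke_gen_bar i : hecke_gen K i * hecke_bar_gen K i = 0.
Proof. by rewrite /hecke_bar_gen mulrBr mulr1 hecke_gen_idem subrr. Qed.

(** The first factor ends with pi_i and the second begins with pi_i - 1, whose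
product is zero by idempotence. *)
Lemma hecke_elt_bar_elt0 i s t : desc i s^-1%g -> desc i t ->
  hecke_elt K s * hecke_bar_elt K t = 0.
Proof.
move=> /hecke_elt_gen -> /hecke_bar_elt_desc ->.
by rewrite mulrA -(mulrA _ (hecke_gen K i)) hecke_gen_bar mulr0 mul0r.
Qed.

(** By induction along hecke_ind, every element of the algebra commutes with f.
*)
Lemma hecke_linear (U V : lmodType (hecke K n)) (f : U -> V) :
    zmod_morphism f ->
    (forall (c : K) u, f (c%:A *: u) = c%:A *: f u) ->
    (forall i u, f (hecke_gen K i *: u) = hecke_gen K i *: f u) ->
  linear f.
Proof.
move=> fB fc fg.
pose fA : {additive U -> V} :=
  HB.pack f (GRing.isZmodMorphism.Build U V f fB).
have fD : {morph f : u v / u + v} := raddfD fA.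
have fZ a u : f (a *: u) = a *: f u.
  elim/hecke_ind: a u => [c|a b iha ihb|i a ih] u; first exact: fc.
    by rewrite !scalerDl fD iha ihb.
  by rewrite -!scalerA fg ih.
by move=> a u v; rewrite fD fZ.
Qed.

End HeckeElements.

(** * Interval modules *)

Section IntervalModules.
Context (K : fieldType) {n : nat}.
Implicit Types (i : 'I_n.-1) (s t sigma rho : 'S_n) (D : {set 'I_n.-1}).

Local Notation H := (hecke K n).

Lemma hecke_scalarM (c d : K) : c%:A * d%:A = (c * d)%:A :> H.
Proof. by rewrite -scalerAl mul1r scalerA. Qed.

Lemma hecke_scalarC (c : K) (a : H) : a * c%:A = c%:A * a.
Proof. by rewrite -scalerAr -scalerAl mulr1 mul1r. Qed.

Lemma itvLE s sigma rho :
  (s \in itvL sigma rho) = weakL sigma s && weakL s rho.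
Proof. by rewrite inE. Qed.

Section Extension.
Variables (sigma rho : 'S_n) (U : lmodType H) (F : 'S_n -> U).
Local Notation itv := {g : 'S_n | g \in itvL sigma rho}.
Local Notation B := (Bmod K sigma rho).
Implicit Types (c : K) (u v : {ffun itv -> K^o}).

Definition Bmod_ext u : U :=
  \sum_g (u g : K)%:A *: F (val g).

Fact Bmod_extB : zmod_morphism (Bmod_ext : B -> U).
Proof.
move=> u v; rewrite /Bmod_ext -sumrB; apply: eq_bigr => g _.
by rewrite !ffunE scalerBl scalerBl.
Qed.

HB.instance Definition _ := GRing.isZmodMorphism.Build B U Bmod_ext Bmod_extB.

Lemma Bmod_extZ c u : Bmod_ext (c *: u) = c%:A *: Bmod_ext u.
Proof.
rewrite /Bmod_ext [RHS]scaler_sumr; apply: eq_bigr => g _.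
by rewrite [RHS]scalerA hecke_scalarM ffunE.
Qed.

Lemma Bmod_ext_bvec g : Bmod_ext (bvec K g) = F (val g).
Proof.
rewrite /Bmod_ext (bigD1 g) //= big1 ?addr0 => [|h hg].
  by rewrite ffunE eqxx scale1r scale1r.
by rewrite ffunE (negPf hg) scale0r scale0r.
Qed.

Lemma Bmod_ext_bvec_opt s : (s \notin itvL sigma rho -> F s = 0) ->
  Bmod_ext (bvec_opt K sigma rho s) = F s.
Proof.
rewrite /bvec_opt => F0; case: insubP => [h _ <-|/F0 ->].
  exact: Bmod_ext_bvec.
exact: (raddf0 (Bmod_ext : {additive B -> U})).
Qed.

(** A family indexed by permutations extends to a linear map when it follows
the rule dem and vanishes where the interval is left through its top; the lower
bound is never crossed, since dem i s lies above s. *)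
Lemma Bmod_ext_linear :
    (forall s, weakL sigma s -> ~~ weakL s rho -> F s = 0) ->
    (forall i s, s \in itvL sigma rho -> hecke_gen K i *: F s = F (dem i s)) ->
  linear (Bmod_ext : B -> U).
Proof.
move=> F0 FS; apply: hecke_linear => [|c u|i u]; first exact: Bmod_extB.
  by rewrite Bmod_scalarE Bmod_extZ.
have -> : hecke_gen K i *: (u : B) = Bmod_op_fun i u.
  by rewrite [LHS]hecke_act_gen //; apply: Bmod_rel.
rewrite /Bmod_op_fun (raddf_sum (Bmod_ext : {additive B -> U})) /=.
rewrite [in RHS]/Bmod_ext scaler_sumr; apply: eq_bigr => g _.
rewrite Bmod_extZ [RHS]scalerA hecke_scalarC -[RHS]scalerA Bmod_genE.
rewrite FS ?(valP g) //.
rewrite Bmod_ext_bvec_opt // itvLE negb_and.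
have le : weakL sigma (dem i (val g)).
  by apply: weakL_trans (dem_weakL i _); have := valP g; rewrite itvLE => /andP[].
by rewrite le /=; apply: F0.
Qed.

End Extension.

Lemma hecke_gen_bvec_opt sigma rho i s : weakL sigma s ->
  hecke_gen K i *: (bvec_opt K sigma rho s : Bmod K sigma rho) =
  bvec_opt K sigma rho (dem i s).
Proof.
move=> le; rewrite -Bmod_op_opt //.
rewrite [LHS]hecke_act_gen //; exact: Bmod_rel.
Qed.

(** Evaluating at f i isolates the coefficient of i. *)
Lemma delta_free (I J : finType) (f : I -> J) (u : {ffun I -> K^o}) :
  injective f -> \sum_i u i *: [ffun j => (j == f i)%:R : K^o] = 0 -> u = 0.
Proof.
move=> f_inj /ffunP u0; apply/ffunP=> i; rewrite ffunE.
have := u0 (f i); rewrite sum_ffunE (bigD1 i) //= big1 => [|j ji].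
  by rewrite !ffunE eqxx addr0 => <-; apply/esym/mulr1.
by rewrite !ffunE (inj_eq f_inj) eq_sym (negPf ji); apply: mulr0.
Qed.

Lemma bvec_opt_free tau sigma rho
    (u : {ffun {g : 'S_n | g \in itvL sigma rho} -> K^o}) :
    {subset itvL sigma rho <= itvL tau rho} ->
    \sum_g (u g : K) *: bvec_opt K tau rho (val g) = 0 ->
  u = 0.
Proof.
move=> sub u0.
pose f (g : {g : 'S_n | g \in itvL sigma rho}) :
    {g : 'S_n | g \in itvL tau rho} := exist _ (val g) (sub _ (valP g)).
apply: (@delta_free _ _ f) => [g h [/val_inj]//|].
rewrite -[RHS]u0; apply: eq_bigr => g _; congr (_ *: _).
by rewrite /bvec_opt -[val g]/(val (f g)) valK.
Qed.

(** Multiplying by the letters of a reduced word, from right to left, always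
meets an ascent, so that the word is built up from the identity; bvec_opt takes
care of leaving the interval. *)
Lemma hecke_elt_bvec_opt rho s :
  hecke_elt K s *: (bvec_opt K 1%g rho 1%g : Bmod K 1%g rho) =
  bvec_opt K 1%g rho s.
Proof.
have [es ls] := reduced_wordP s; rewrite /hecke_elt -[in RHS]es.
have : reduced (reduced_word s) by rewrite /reduced es ls.
elim: (reduced_word s) => [_|i w ih rw]; first by rewrite big_nil; exact: scale1r.
have [rw' d] := reduced_cons rw.
rewrite big_cons -scalerA ih // hecke_gen_bvec_opt ?weakL1 // demE.
by move: d; rewrite /= desc_simple => /negPf ->.
Qed.

(** A reduced word of the longest element of W_D has its letters in D, and for
d in D the permutation s_d is not below the upper bound: pi_d kills the
identity, on which pi_d - 1 acts by -1. *)
Lemma hecke_bar_elt_bvec_opt D :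
  hecke_bar_elt K (w0_par D) *:
    (bvec_opt K 1%g (w0 \oS w0_par D) 1%g : Bmod K 1%g (w0 \oS w0_par D)) =
  (-1) ^+ len (w0_par D) *:
    (bvec_opt K 1%g (w0 \oS w0_par D) 1%g : Bmod K 1%g (w0 \oS w0_par D)).
Proof.
have [e l] := reduced_wordP (w0_par D); rewrite /hecke_bar_elt -[in RHS]l.
have : all [in D] (reduced_word (w0_par D)).
  by apply: parabolic_word; rewrite ?e ?w0_par_mem // /reduced e l.
elim: (reduced_word _) => [|i w ih] /=; first by rewrite big_nil expr0.
case/andP=> iD wD; rewrite big_cons -[LHS]scalerA ih // [LHS]scalerA.
rewrite (commrX (size w) (commrN1 (hecke_bar_gen K i))).
rewrite exprSr -[LHS]scalerA -[RHS]scalerA; congr (_ *: _).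
rewrite scalerBl scale1r scaleN1r hecke_gen_bvec_opt ?weakL1 // demE.
have -> : desc i 1%g = false.
  by rewrite /desc invg1 !perm1 /= ltnNge leqnSn.
rewrite {1}/bvec_opt insubF ?sub0r // itvLE.
have -> : simple i \oS 1%g = simple i by rewrite /perm_comp mul1g.
by rewrite (negPf (simple_not_weakL iD)) andbF.
Qed.

(** * The projective module *)

Section Projective.
Variable D : {set 'I_n.-1}.
Local Notation sigma := (w0_par (~: D)).
Local Notation rho := (w0 \oS w0_par D).

(** The multiple of bar-pi that corresponds to s; at sigma it generates the
module. *)
Definition proj_elt s : H := hecke_elt K s * hecke_bar_elt K (w0_par D).

Local Notation P := (left_ideal (proj_elt sigma)).

Lemma proj_elt0 s : ~~ weakL s rho -> proj_elt s = 0.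
Proof.
case/not_weakL_desc=> d dD ds.
by rewrite /proj_elt (hecke_elt_bar_elt0 _ ds) ?w0_par_desc.
Qed.

Lemma proj_elt_gen i s : hecke_gen K i * proj_elt s = proj_elt (dem i s).
Proof. by rewrite /proj_elt mulrA hecke_gen_elt. Qed.

Lemma proj_elt_in s : weakL sigma s ->
  proj_elt s \in in_left_ideal (proj_elt sigma).
Proof.
case/existsP=> g /andP[/eqP e /eqP l]; apply/asboolP; exists (hecke_elt K g).
by rewrite /proj_elt mulrA -hecke_elt_comp -?e.
Qed.

(** Totalised to all permutations, with default 0 outside the left ideal; only
values above sigma matter. *)
Definition proj_vec s : P := insubd (0 : P) (proj_elt s : H^o).

Lemma proj_vecE s : weakL sigma s -> val (proj_vec s) = proj_elt s.
Proof. by move=> /proj_elt_in; exact: insubdK. Qed.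

Lemma proj_vec0 s : weakL sigma s -> ~~ weakL s rho -> proj_vec s = 0.
Proof. by move=> /proj_vecE es /proj_elt0 e0; apply: val_inj; rewrite es e0. Qed.

Lemma proj_vec_gen i s : s \in itvL sigma rho ->
  hecke_gen K i *: proj_vec s = proj_vec (dem i s).
Proof.
rewrite itvLE => /andP[le _]; apply: val_inj.
rewrite proj_vecE ?(weakL_trans le (dem_weakL i s)) // -proj_elt_gen.
by rewrite -(proj_vecE le).
Qed.

Lemma proj_elt_bvec_opt s :
  proj_elt s *: (bvec_opt K 1%g rho 1%g : Bmod K 1%g rho) =
  (-1) ^+ len (w0_par D) *: (bvec_opt K 1%g rho s : Bmod K 1%g rho).
Proof.
rewrite /proj_elt -[LHS]scalerA hecke_bar_elt_bvec_opt [LHS]scalerA.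
by rewrite (commrX _ (commrN1 _)) -[LHS]scalerA hecke_elt_bvec_opt.
Qed.

(** Acting on the identity in the module of [1, rho], the element attached to g
gives g up to a sign that does not depend on g. *)
Lemma proj_elt_free (u : {ffun {g : 'S_n | g \in itvL sigma rho} -> K^o}) :
  \sum_g (u g : K)%:A * proj_elt (val g) = 0 -> u = 0.
Proof.
pose e s := bvec_opt K 1%g rho s : Bmod K 1%g rho.
pose eps : H := (-1) ^+ len (w0_par D).
have epsK (v : Bmod K 1%g rho) : eps *: (eps *: v) = v.
  by rewrite [LHS]scalerA -expr2 sqrr_sign [LHS]scale1r.
move=> u0.
have {u0} :
    eps *: ((\sum_g (u g : K)%:A * proj_elt (val g)) *: e 1%g) = 0.
  by rewrite u0 scale0r scaler0.
rewrite scaler_suml scaler_sumr => u0.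
apply: (@bvec_opt_free 1%g); first by move=> g; rewrite !itvLE weakL1 => /andP[].
rewrite -[RHS]u0; apply: eq_bigr => g _.
rewrite -Bmod_scalarE -[in RHS]scalerA proj_elt_bvec_opt -/eps.
by rewrite [RHS]scalerA hecke_scalarC -[RHS]scalerA epsK.
Qed.

Lemma sigma_itv : sigma \in itvL sigma rho.
Proof. by rewrite itvLE weakL_refl weakL_w0_par. Qed.

Lemma proj_iso : lmod_iso P (Bmod K sigma rho).
Proof.
apply: lmod_iso_sym.
have fl := Bmod_ext_linear proj_vec0 proj_vec_gen.
pose f : {linear Bmod K sigma rho -> P} :=
  HB.pack (Bmod_ext proj_vec)
    (GRing.isLinear.Build H (Bmod K sigma rho) P *:%R _ fl).
exists f.
have f_inj : injective f.
  apply: raddf_inj => u fu0.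
  apply: proj_elt_free; rewrite -[RHS](congr1 val fu0).
  apply/esym/(etrans (raddf_sum (val : {additive P -> H^o}) _ _ _)).
  apply: eq_bigr => g _.
  congr (_ * _); apply: proj_vecE.
  by have := valP g; rewrite itvLE => /andP[].
have f_surj x : exists u, f u = x.
  case: x => x xP; have /asboolP[a ea] := xP.
  exists (a *: (bvec_opt K sigma rho sigma : Bmod K sigma rho)).
  rewrite linearZ /= Bmod_ext_bvec_opt; last by rewrite sigma_itv.
  apply: val_inj; rewrite [RHS]ea; congr (a * _).
  exact/proj_vecE/weakL_refl.
have [g gK] := choice f_surj.
by exists g => // u; apply: f_inj; rewrite gK.
Qed.

End Projective.

(** * The one-dimensional module *)

Section OneDimensional.
Variable alpha : composition n.
Local Notation D := (comp_set alpha).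
Local Notation sigma := (w0_par (~: D)).

Lemma itvL_refl s t : (t \in itvL s s) = (t == s).
Proof.
rewrite itvLE; apply/idP/eqP => [|->]; last by rewrite weakL_refl.
case/andP=> /existsP[g /andP[/eqP e /eqP l]] /existsP[h /andP[/eqP e' /eqP l']].
have [w lw] := reduced_wordP g; have g0 : size (reduced_word g) = 0%N by lia.
by rewrite e -w (size0nil g0) perm_comp1s.
Qed.

Definition line_vec s : Fmod K alpha := if s == sigma then (1 : K) else 0.

Lemma line_iso : lmod_iso (Fmod K alpha) (Bmod K sigma sigma).
Proof.
apply: lmod_iso_sym.
have F0 s : weakL sigma s -> ~~ weakL s sigma -> line_vec s = 0.
  by rewrite /line_vec; case: eqP => // ->; rewrite weakL_refl.
have FS i s : s \in itvL sigma sigma ->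
    hecke_gen K i *: line_vec s = line_vec (dem i s).
  rewrite itvL_refl => /eqP ->; rewrite Fmod_genE demE w0_par_desc in_setC.
  case: (i \in D) => //=; rewrite /line_vec ifN //; apply/eqP=> e.
  by have := desc_simple i sigma; rewrite e; case: desc.
have fl := Bmod_ext_linear F0 FS.
pose f : {linear Bmod K sigma sigma -> Fmod K alpha} :=
  HB.pack (Bmod_ext line_vec)
    (GRing.isLinear.Build H (Bmod K sigma sigma) (Fmod K alpha) *:%R _ fl).
exists f.
have s_in : sigma \in itvL sigma sigma by rewrite itvL_refl.
pose g0 : {g | g \in itvL sigma sigma} := exist _ sigma s_in.
have g0E g : g = g0 by apply: val_inj; apply/eqP; rewrite -itvL_refl (valP g).
have fE u : f u = (u : {ffun _ -> K^o}) g0.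
  rewrite /= /Bmod_ext (bigD1 g0) //= big1 ?addr0 => [|g].
    by rewrite Fmod_scalarE /line_vec eqxx mulr1.
  by rewrite (g0E g) eqxx.
exists (fun c : Fmod K alpha => [ffun=> (c : K^o)] : Bmod K sigma sigma).
  by move=> u; apply/ffunP=> g; rewrite ffunE fE (g0E g).
by move=> c; rewrite fE ffunE.
Qed.

End OneDimensional.

End IntervalModules.

Theorem mainTheorem2 (R : realType) (n : nat) (alpha : composition n) :
  lmod_iso (Pmod R[i] alpha)
           (Bmod R[i] (w0_comp (comp_compl alpha)) (w0 \oS w0_comp alpha))
  /\ lmod_iso (Fmod R[i] alpha)
              (Bmod R[i] (w0_comp (comp_compl alpha))
                         (w0_comp (comp_compl alpha))).
Proof.
rewrite /Pmod /w0_comp comp_complP.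
by split; [apply: proj_iso|apply: line_iso].
Qed.
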